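(* The logic $\mathcal{DHMSH}$ is algebraizable, and the variety $\mathbb{DHMSH}$ is the equivalent algebraic semantics for $\mathcal{DHMSH}$ with the defining identity $p\approx p\to_H p$ (equivalently, $p\approx1$) and the equivalence formulas $\Delta=\{p\to_H q,\ q\to_H p\}$.
   Context: Language: $\langle\vee,\wedge,\to,\sim,\bot,\top\rangle$ of arities $2,2,2,1,0,0$; formulas are built over a countably infinite set of propositional variables. The abbreviation $\alpha\to_H\beta$ stands for $\alpha\to(\alpha\wedge\beta)$. The logic $\mathcal{DHMSH}$ is the Hilbert-style logic with axiom schemes: (A1) $\alpha\to_H(\alpha\vee\beta)$; (A2) $\beta\to_H(\alpha\vee\beta)$; (A3) $(\alpha\to_H\gamma)\to_H[(\beta\to_H\gamma)\to_H((\alpha\vee\beta)\to_H\gamma)]$; (A4) $(\alpha\wedge\beta)\to_H\alpha$; (A5) $(\gamma\to_H\alpha)\to_H[(\gamma\to_H\beta)\to_H(\gamma\to_H(\alpha\wedge\beta))]$; (A6) $\top$; (A7) $\bot\to_H\alpha$; (A8) $((\alpha\wedge\beta)\to_H\gamma)\to_H(\alpha\to_H(\beta\to_H\gamma))$; (A9) $(\alpha\to_H(\beta\to_H\gamma))\to_H((\alpha\wedge\beta)\to_H\gamma)$; (A10) $(\alpha\to_H\beta)\to_H((\beta\to_H\alpha)\to_H((\alpha\to\gamma)\to_H(\beta\to\gamma)))$; (A11) $(\alpha\to_H\beta)\to_H((\beta\to_H\alpha)\to_H((\gamma\to\beta)\to_H(\gamma\to\alpha)))$; (A12) $\top\to_H{\sim}\bot$;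 (A13) ${\sim}\top\to_H\bot$; (A14) ${\sim}(\alpha\wedge\beta)\to_H({\sim}\alpha\vee{\sim}\beta)$; and rules (SMP): from $\phi$ and $\phi\to_H\gamma$ deduce $\gamma$; (SCP): from $\phi\to_H\gamma$ deduce ${\sim}\gamma\to_H{\sim}\phi$. $\Gamma\vdash\phi$ means that $\phi$ is derivable from axioms and members of $\Gamma$ by these rules (both rules may be applied to any formulas already derived from $\Gamma$). A semi-Heyting algebra is an algebra $\langle L,\vee,\wedge,\to,0,1\rangle$ such that $\langle L,\vee,\wedge,0,1\rangle$ is a lattice with $0$ and $1$, and $x\wedge(x\to y)\approx x\wedge y$, $x\wedge(y\to z)\approx x\wedge[(x\wedge y)\to(x\wedge z)]$, $x\to x\approx1$. $\mathbb{DHMSH}$ is the variety of algebras $\langle A,\vee,\wedge,\to,{}',0,1\rangle$ such that $\langle A,\vee,\wedge,\to,0,1\rangle$ is a semi-Heyting algebra and $0'\approx1$, $1'\approx0$, $(x\wedge y)'\approx x'\vee y'$. Formulas are interpreted with $\sim,\bot,\top$ as ${}',0,1$. For a class $\mathbb K$ of algebras, $\models_{\mathbb K}$ is the equational consequence relation: a set $E$ of identities entails $\alpha\approx\beta$ if for every $\mathbf A\in\mathbb K$, every interpretation in $\mathbf A$ satisfying all identities in $E$ satisfies $\alpha\approx\beta$. $\mathbb K$ is an algebraic semantics for a logic $\mathcal L$ with defining identities $\delta_i(p)\approx\epsilon_i(p)$ $(i<n)$ if for all $\Gamma\cup\{\phi\}$ and each $j<n$: $\Gamma\vdash_{\mathcal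 L}\phi\iff\{\delta_i(\psi)\approx\epsilon_i(\psi):i<n,\psi\in\Gamma\}\models_{\mathbb K}\delta_j(\phi)\approx\epsilon_j(\phi)$. It is an equivalent algebraic semantics with equivalence formulas $\Delta_j(p,q)$ $(j<m)$ if moreover, for all formulas $\phi,\psi$, the identity $\phi\approx\psi$ and the set $\{\delta_i(\Delta_j(\phi,\psi))\approx\epsilon_i(\Delta_j(\phi,\psi)):i<n,j<m\}$ entail each other under $\models_{\mathbb K}$. $\mathcal L$ is algebraizable if it has an equivalent algebraic semantics. *)

(* Defs.v *)
From Stdlib Require Export List.
Export ListNotations.

Set Implicit Arguments.

(* Formulas are parametrised by the set [V] of variables: the object language
   is [form nat], while [form unit] and [form bool] are the formulas in one
   variable p and in two variables p, q. *)
Inductive form (V : Type) : Type :=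
| Var (v : V)
| Or (a b : form V)
| And (a b : form V)
| Imp (a b : form V)
| Neg (a : form V)
| Bot
| Top.

Arguments Bot {V}.
Arguments Top {V}.

Definition ImpH (V : Type) (a b : form V) : form V := Imp a (And a b).

Declare Scope form_scope.
Delimit Scope form_scope with F.
Bind Scope form_scope with form.
Notation "a || b" := (Or a b) : form_scope.
Notation "a && b" := (And a b) : form_scope.
Notation "a --> b" := (Imp a b)
  (at level 55, right associativity) : form_scope.
Notation "a -->H b" := (ImpH a b)
  (at level 55, right associativity) : form_scope.
Notation "~~ a" := (Neg a) (at level 35, right associativity) : form_scope.

Fixpoint subst (V W : Type) (s : V -> form W) (a : form V) : form W :=
  match a with
  | Var v => s v
  | Or a b => Or (subst s a) (subst s b)
  | And a b => And (subst s a) (subst s b)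
  | Imp a b => Imp (subst s a) (subst s b)
  | Neg a => Neg (subst s a)
  | Bot => Bot
  | Top => Top
  end.

Definition formula : Type := form nat.
Bind Scope form_scope with formula.

(* [d] is d(p), and [inst1 d phi] is d(phi). *)
Definition inst1 (d : form unit) (phi : formula) : formula :=
  subst (fun _ => phi) d.

(* [D] is D(p, q) with p = [Var false] and q = [Var true]. *)
Definition inst2 (D : form bool) (phi psi : formula) : formula :=
  subst (fun b : bool => if b then psi else phi) D.

Definition logic : Type := (formula -> Prop) -> formula -> Prop.

Inductive DHMSH_axiom : formula -> Prop :=
| A1 a b : DHMSH_axiom (a -->H (a || b))
| A2 a b : DHMSH_axiom (b -->H (a || b))
| A3 a b c :
    DHMSH_axiom ((a -->H c) -->H ((b -->H c) -->H ((a || b) -->H c)))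
| A4 a b : DHMSH_axiom ((a && b) -->H a)
| A5 a b c :
    DHMSH_axiom ((c -->H a) -->H ((c -->H b) -->H (c -->H (a && b))))
| A6 : DHMSH_axiom Top
| A7 a : DHMSH_axiom (Bot -->H a)
| A8 a b c : DHMSH_axiom (((a && b) -->H c) -->H (a -->H (b -->H c)))
| A9 a b c : DHMSH_axiom ((a -->H (b -->H c)) -->H ((a && b) -->H c))
| A10 a b c :
    DHMSH_axiom ((a -->H b) -->H ((b -->H a) -->H ((a --> c) -->H (b --> c))))
| A11 a b c :
    DHMSH_axiom ((a -->H b) -->H ((b -->H a) -->H ((c --> b) -->H (c --> a))))
| A12 : DHMSH_axiom (Top -->H ~~ Bot)
| A13 : DHMSH_axiom (~~ Top -->H Bot)
| A14 a b : DHMSH_axiom (~~ (a && b) -->H (~~ a || ~~ b)).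

Inductive DHMSH_logic (Gamma : formula -> Prop) : formula -> Prop :=
| Ax phi : DHMSH_axiom phi -> DHMSH_logic Gamma phi
| Hyp phi : Gamma phi -> DHMSH_logic Gamma phi
| SMP phi gamma :
    DHMSH_logic Gamma phi -> DHMSH_logic Gamma (phi -->H gamma) ->
    DHMSH_logic Gamma gamma
| SCP phi gamma :
    DHMSH_logic Gamma (phi -->H gamma) ->
    DHMSH_logic Gamma (~~ gamma -->H ~~ phi).

Record algebra : Type := Algebra {
  carrier :> Type;
  join : carrier -> carrier -> carrier;
  meet : carrier -> carrier -> carrier;
  imp : carrier -> carrier -> carrier;
  neg : carrier -> carrier;
  zero : carrier;
  one : carrier }.

Arguments join {a} _ _.
Arguments meet {a} _ _.
Arguments imp {a} _ _.
Arguments neg {a} _.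
Arguments zero {a}.
Arguments one {a}.

Record is_bounded_lattice (A : algebra) : Prop := IsBoundedLattice {
  joinC : forall x y : A, join x y = join y x;
  joinA : forall x y z : A, join x (join y z) = join (join x y) z;
  meetC : forall x y : A, meet x y = meet y x;
  meetA : forall x y z : A, meet x (meet y z) = meet (meet x y) z;
  joinKI : forall x y : A, join x (meet x y) = x;
  meetKU : forall x y : A, meet x (join x y) = x;
  join0x : forall x : A, join zero x = x;
  meet1x : forall x : A, meet one x = x }.

Record is_semi_Heyting (A : algebra) : Prop := IsSemiHeyting {
  semi_Heyting_lattice : is_bounded_lattice A;
  meet_imp : forall x y : A, meet x (imp x y) = meet x y;
  meet_imp_meet : forall x y z : A,
    meet x (imp y z) = meet x (imp (meet x y) (meet x z));
  impxx : forall x : A, imp x x = one }.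

Record DHMSH (A : algebra) : Prop := IsDHMSH {
  DHMSH_semi_Heyting : is_semi_Heyting A;
  neg0 : neg (zero : A) = one;
  neg1 : neg (one : A) = zero;
  negI : forall x y : A, neg (meet x y) = join (neg x) (neg y) }.

Fixpoint eval (V : Type) (A : algebra) (h : V -> A) (a : form V) : A :=
  match a with
  | Var v => h v
  | Or a b => join (eval A h a) (eval A h b)
  | And a b => meet (eval A h a) (eval A h b)
  | Imp a b => imp (eval A h a) (eval A h b)
  | Neg a => neg (eval A h a)
  | Bot => zero
  | Top => one
  end.

Definition identity (V : Type) : Type := (form V * form V)%type.

Definition satisfies (A : algebra) (h : nat -> A) (e : identity nat) : Prop :=
  eval A h (fst e) = eval A h (snd e).

Definition entails (K : algebra -> Prop)
    (E : identity nat -> Prop) (e : identity nat) : Prop :=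
  forall A : algebra, K A -> forall h : nat -> A,
    (forall e', E e' -> satisfies A h e') -> satisfies A h e.

Definition inst_identity (de : identity unit) (phi : formula) : identity nat :=
  (inst1 (fst de) phi, inst1 (snd de) phi).

Definition translation (defs : list (identity unit)) (Gamma : formula -> Prop)
    (e : identity nat) : Prop :=
  exists de psi, In de defs /\ Gamma psi /\ e = inst_identity de psi.

(* At least one defining identity is required: without any, the biconditional
   would be vacuous and every logic would be algebraizable. *)
Definition algebraic_semantics (L : logic) (K : algebra -> Prop)
    (defs : list (identity unit)) : Prop :=
  defs <> [] /\
  forall (Gamma : formula -> Prop) (phi : formula) (de : identity unit),
    In de defs ->
    (L Gamma phi <->
     entails K (translation defs Gamma) (inst_identity de phi)).

Definition equivalent_algebraic_semantics (L : logic) (K : algebra -> Prop)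
    (defs : list (identity unit)) (Delta : list (form bool)) : Prop :=
  algebraic_semantics L K defs /\
  forall phi psi : formula,
    let E := translation defs
      (fun chi => exists D, In D Delta /\ chi = inst2 D phi psi) in
    (forall e, E e -> entails K (fun e' => e' = (phi, psi)) e) /\
    entails K E (phi, psi).

Definition algebraizable (L : logic) : Prop :=
  exists (K : algebra -> Prop) (defs : list (identity unit))
    (Delta : list (form bool)), equivalent_algebraic_semantics L K defs Delta.

Definition defining_identity_H : identity unit :=
  (Var tt, Var tt -->H Var tt)%F.

Definition defining_identity_1 : identity unit := (Var tt, Top).

Definition DHMSH_Delta : list (form bool) :=
  [Var false -->H Var true; Var true -->H Var false]%F.

(* Main.v *)
Require Import Defs.
From Stdlib Require Import ClassicalEpsilon FunctionalExtensionality.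
From Stdlib Require Import PropExtensionality ProofIrrelevance.

Set Implicit Arguments.

(** The proof is the classical Lindenbaum-Tarski argument, in its version
    relative to a set [Gamma] of hypotheses.

    Soundness. In a semi-Heyting algebra [x -> (x /\ y)] is the Heyting
    implication of the underlying lattice ([below_impH]), so it equals 1 exactly
    when [x <= y] ([impH_eq_one]). The axioms thus become inequalities between
    lattice terms. The only ones that mention the semi-Heyting arrow itself,
    (A10) and (A11), follow from [x /\ (y -> z) = x /\ (x /\ y -> x /\ z)].

    Completeness. Order formulas by [a <= b] iff [Gamma] proves [a -->H b], and
    quotient by the induced equivalence. The quotient is an algebra of DHMSH in
    which the class of [a] is 1 exactly when [Gamma] proves [a], so that a
    formula which is not derivable from [Gamma] is refuted there.

    The delicate point is that [<=] is a preorder, for the axioms contain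
    neither [a -->H a] nor any form of transitivity; at first only modus ponens
    and currying are available. Write [u] for [a -->H a]. Then [a <= u] is an
    instance of [a -->H (b -->H a)], that is, [a --> (a && u)] is derivable;
    moreover [a && u] and [a && a] are equivalent, so (A11) replaces one by the
    other and yields [a --> (a && a)], which is [a -->H a] ([le_refl]).
    For transitivity, (A11) allows equivalent formulas to be exchanged on the
    right of [<=] ([le_eqv_r]); together with currying this shows that all the
    components of a triple conjunction lie above it, which is what is needed to
    exchange equivalent formulas on the left of [<=] by (A10) ([le_eqv_l]).
    Since [a <= b] makes [a] equivalent to [a && b], transitivity follows. *)

Arguments Ax {Gamma phi} _.
Arguments Hyp {Gamma phi} _.
Arguments SMP {Gamma phi gamma} _ _.
Arguments SCP {Gamma phi gamma} _.

(** * Order and residuation in semi-Heyting algebras *)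

(** The lattice order of an algebra, defined from the meet. *)
Definition below (A : algebra) (x y : A) : Prop := meet x y = x.
Arguments below {A} x y.

(** The algebraic counterpart of [-->H]. *)
Definition impH (A : algebra) (x y : A) : A := imp x (meet x y).
Arguments impH {A} x y.

Lemma meetxx (A : algebra) (L : is_bounded_lattice A) (x : A) : meet x x = x.
Proof. rewrite <- (joinKI L x x) at 2. apply (meetKU L). Qed.

Lemma below_refl (A : algebra) (L : is_bounded_lattice A) (x : A) : below x x.
Proof. exact (meetxx L x). Qed.

Lemma below_trans (A : algebra) (L : is_bounded_lattice A) (x y z : A) :
  below x y -> below y z -> below x z.
Proof.
  unfold below; intros xy yz.
  rewrite <- xy at 1. now rewrite <- (meetA L), yz.
Qed.

Lemma below_antisym (A : algebra) (L : is_bounded_lattice A) (x y : A) :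
  below x y -> below y x -> x = y.
Proof. unfold below; intros xy yx. now rewrite <- xy, (meetC L). Qed.

Lemma below_meetl (A : algebra) (L : is_bounded_lattice A) (x y z : A) :
  below x z -> below (meet x y) z.
Proof.
  unfold below; intros xz.
  now rewrite (meetC L x y), <- (meetA L), xz.
Qed.

Lemma below_meetr (A : algebra) (L : is_bounded_lattice A) (x y z : A) :
  below y z -> below (meet x y) z.
Proof. intros yz. rewrite (meetC L). now apply below_meetl. Qed.

Lemma below_meet (A : algebra) (L : is_bounded_lattice A) (x y z : A) :
  below z x -> below z y -> below z (meet x y).
Proof. unfold below; intros zx zy. now rewrite (meetA L), zx. Qed.

Lemma below_joinl (A : algebra) (L : is_bounded_lattice A) (x y : A) :
  below x (join x y).
Proof. exact (meetKU L x y). Qed.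

Lemma below_joinr (A : algebra) (L : is_bounded_lattice A) (x y : A) :
  below y (join x y).
Proof. rewrite (joinC L). exact (meetKU L y x). Qed.

Lemma below_join_eq (A : algebra) (L : is_bounded_lattice A) (x y : A) :
  below x y <-> join x y = y.
Proof.
  unfold below; split; intros E.
  - rewrite <- E, (joinC L), (meetC L). apply (joinKI L).
  - rewrite <- E. apply (meetKU L).
Qed.

Lemma below_join (A : algebra) (L : is_bounded_lattice A) (x y z : A) :
  below x z -> below y z -> below (join x y) z.
Proof.
  rewrite !(below_join_eq L); intros xz yz.
  now rewrite <- (joinA L), yz.
Qed.

Lemma below_one (A : algebra) (L : is_bounded_lattice A) (x : A) : below x one.
Proof. unfold below. rewrite (meetC L). apply (meet1x L). Qed.

Lemma below_zero (A : algebra) (L : is_bounded_lattice A) (x : A) :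
  below zero x.
Proof. apply (below_join_eq L), (join0x L). Qed.

(** Proves inequalities between meets that hold in every meet-semilattice,
    with the hypotheses as inequalities between the components. *)
Ltac meets L :=
  repeat apply (below_meet L);
  solve [ assumption | apply (below_refl L)
        | apply (below_meetl L); meets L | apply (below_meetr L); meets L ].

(** Residuation: [impH] is the Heyting implication of the lattice. *)
Lemma below_impH (A : algebra) (H : is_semi_Heyting A) (x y z : A) :
  below z (impH x y) <-> below (meet z x) y.
Proof.
  pose proof (semi_Heyting_lattice H) as L.
  unfold impH; split; intros E.
  - apply (below_trans L) with (meet x (imp x (meet x y))); [meets L|].
    rewrite (meet_imp H). meets L.
  - unfold below in *.
    rewrite (meet_imp_meet H), (meetA L), E, (impxx H), (meetC L).
    apply (meet1x L).
Qed.

Lemma impH_eq_one (A : algebra) (H : is_semi_Heyting A) (x y : A) :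
  impH x y = one <-> below x y.
Proof.
  pose proof (semi_Heyting_lattice H) as L.
  split; intros E.
  - rewrite <- (meet1x L x). apply (below_impH H). rewrite E. apply (below_refl L).
  - apply (below_antisym L); [apply (below_one L)|].
    apply (below_impH H). now rewrite (meet1x L).
Qed.

Lemma below_modus_ponens (A : algebra) (H : is_semi_Heyting A) (x y z : A) :
  below z (impH x y) -> below z x -> below z y.
Proof.
  intros zxy zx. pose proof (semi_Heyting_lattice H) as L.
  apply (below_trans L) with (meet z x); [meets L|]. now apply (below_impH H).
Qed.

Lemma meet_biimpH (A : algebra) (H : is_semi_Heyting A) (x y : A) :
  meet (meet (impH x y) (impH y x)) x = meet (meet (impH x y) (impH y x)) y.
Proof.
  pose proof (semi_Heyting_lattice H) as L.
  apply (below_antisym L); apply (below_meet L); try meets L.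
  - apply (below_modus_ponens H) with (x := x); meets L.
  - apply (below_modus_ponens H) with (x := y); meets L.
Qed.

Lemma impH_imp_compatl (A : algebra) (H : is_semi_Heyting A) (x y z : A) :
  below (meet (meet (impH x y) (impH y x)) (imp x z)) (imp y z).
Proof.
  pose proof (semi_Heyting_lattice H) as L.
  rewrite (meet_imp_meet H), (meet_biimpH H), <- (meet_imp_meet H). meets L.
Qed.

Lemma impH_imp_compatr (A : algebra) (H : is_semi_Heyting A) (x y z : A) :
  below (meet (meet (impH x y) (impH y x)) (imp z y)) (imp z x).
Proof.
  pose proof (semi_Heyting_lattice H) as L.
  rewrite (meet_imp_meet H), <- (meet_biimpH H), <- (meet_imp_meet H). meets L.
Qed.

Lemma below_neg (A : algebra) (D : DHMSH A) (x y : A) :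
  below x y -> below (neg y) (neg x).
Proof.
  pose proof (semi_Heyting_lattice (DHMSH_semi_Heyting D)) as L.
  unfold below at 1; intros xy. rewrite <- xy, (negI D). apply (below_joinr L).
Qed.

(** * Soundness *)

Lemma eval_ImpH (V : Type) (A : algebra) (h : V -> A) (a b : form V) :
  eval A h (a -->H b) = impH (eval A h a) (eval A h b).
Proof. reflexivity. Qed.

Lemma axiom_sound (A : algebra) (D : DHMSH A) (h : nat -> A) (phi : formula) :
  DHMSH_axiom phi -> eval A h phi = one.
Proof.
  pose proof (DHMSH_semi_Heyting D) as H.
  pose proof (semi_Heyting_lattice H) as L.
  intros [a b|a b|a b c|a b|a b c| |a|a b c|a b c|a b c|a b c| | |a b];
    rewrite ?eval_ImpH; cbn [eval]; try apply (impH_eq_one H);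
    try set (x := eval A h a); try set (y := eval A h b);
    try set (z := eval A h c).
  - apply (below_joinl L).
  - apply (below_joinr L).
  - (* Instead of distributing over the join, bring it to the left of the
       residuation, where it is a supremum. *)
    apply (below_impH H), (below_impH H). rewrite (meetC L).
    apply (below_impH H), (below_join L); apply (below_impH H).
    + apply (below_modus_ponens H) with (x := x); meets L.
    + apply (below_modus_ponens H) with (x := y); meets L.
  - meets L.
  - apply (below_impH H), (below_impH H), (below_meet L);
      apply (below_modus_ponens H) with (x := z); meets L.
  - reflexivity.
  - apply (below_zero L).
  - do 2 apply (below_impH H).
    apply (below_modus_ponens H) with (x := meet x y); meets L.
  - apply (below_impH H).
    apply (below_modus_ponens H) with (x := y); [|meets L].
    apply (below_modus_ponens H) with (x := x); meets L.
  - apply (below_impH H), (below_impH H), (impH_imp_compatl H).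
  - apply (below_impH H), (below_impH H), (impH_imp_compatr H).
  - rewrite (neg0 D). apply (below_refl L).
  - rewrite (neg1 D). apply (below_refl L).
  - rewrite (negI D). apply (below_refl L).
Qed.

Lemma soundness (A : algebra) (D : DHMSH A) (h : nat -> A)
    (Gamma : formula -> Prop) (phi : formula) :
  (forall psi, Gamma psi -> eval A h psi = one) ->
  DHMSH_logic Gamma phi -> eval A h phi = one.
Proof.
  pose proof (DHMSH_semi_Heyting D) as H.
  pose proof (semi_Heyting_lattice H) as L.
  intros HG. induction 1 as [phi Hax|phi Hphi|phi gamma _ E1 _ E2|phi gamma _ E].
  - now apply axiom_sound.
  - now apply HG.
  - rewrite eval_ImpH, E1 in E2. apply (impH_eq_one H) in E2.
    unfold below in E2. now rewrite (meet1x L) in E2.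
  - rewrite eval_ImpH in E |- *. apply (impH_eq_one H). cbn [eval].
    apply (below_neg D). now apply (impH_eq_one H).
Qed.

(** * The preorder of formulas *)

Notation "a <=[ G ] b" := (DHMSH_logic G (a -->H b)%F) (at level 70).

Section Logic.

Context {Gamma : formula -> Prop}.

(** Interderivability of two formulas, relative to the hypotheses [Gamma]. *)
Definition eqv (a b : formula) : Prop := a <=[Gamma] b /\ b <=[Gamma] a.

Lemma eqv_sym a b : eqv a b -> eqv b a.
Proof. now intros [ab ba]. Qed.

Lemma le_curry a b c : a && b <=[Gamma] c -> a <=[Gamma] (b -->H c).
Proof. intros E. exact (SMP E (Ax (A8 a b c))). Qed.

Lemma le_uncurry a b c : a <=[Gamma] (b -->H c) -> a && b <=[Gamma] c.
Proof. intros E. exact (SMP E (Ax (A9 a b c))). Qed.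

Lemma le_andl a b : a && b <=[Gamma] a.
Proof. exact (Ax (A4 a b)). Qed.

Lemma le_and a b c : c <=[Gamma] a -> c <=[Gamma] b -> c <=[Gamma] a && b.
Proof. intros ca cb. exact (SMP cb (SMP ca (Ax (A5 a b c)))). Qed.

Lemma le_const a b : a <=[Gamma] (b -->H a).
Proof. apply le_curry, le_andl. Qed.

Lemma le_thm a b : DHMSH_logic Gamma a -> b <=[Gamma] a.
Proof. intros E. exact (SMP E (le_const a b)). Qed.

Lemma and_le_r a b c : b <=[Gamma] c -> a && b <=[Gamma] c.
Proof. intros E. now apply le_uncurry, le_thm. Qed.

Lemma Imp_eqv_r a b c : eqv a b ->
  DHMSH_logic Gamma (c --> a)%F -> DHMSH_logic Gamma (c --> b)%F.
Proof.
  intros [ab ba] E. exact (SMP E (SMP ab (SMP ba (Ax (A11 b a c))))).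
Qed.

Lemma Imp_eqv_l a b c : eqv a b ->
  DHMSH_logic Gamma (a --> c)%F -> DHMSH_logic Gamma (b --> c)%F.
Proof.
  intros [ab ba] E. exact (SMP E (SMP ba (SMP ab (Ax (A10 a b c))))).
Qed.

Lemma le_eqv_r a b c : eqv b c -> a <=[Gamma] b -> a <=[Gamma] c.
Proof.
  intros [bc cb]. apply Imp_eqv_r; split; apply le_and;
    auto using le_andl, and_le_r.
Qed.

(** Reflexivity is not an axiom; it comes from [a <=[Gamma] (a -->H a)]. *)
Lemma le_refl a : a <=[Gamma] a.
Proof.
  assert (E : a <=[Gamma] (a -->H a)) by apply le_const.
  unfold ImpH at 1 in E. refine (Imp_eqv_r _ E).
  split; apply le_and; auto using le_andl, and_le_r.
Qed.

Lemma le_andr a b : a && b <=[Gamma] b.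
Proof. apply and_le_r, le_refl. Qed.

Lemma le_and3 a b c : (a && b) && c <=[Gamma] a.
Proof.
  apply le_uncurry, le_uncurry.
  (* Up to currying inside the consequent, this is [le_const a (b && c)]. *)
  apply le_eqv_r with (b && c -->H a)%F.
  - split; apply Ax; [apply A8|apply A9].
  - apply le_const.
Qed.

Lemma le_and3_mid a b c : (a && b) && c <=[Gamma] b.
Proof. apply le_uncurry, le_uncurry, le_thm, le_const. Qed.

Lemma le_andC a b c : a && b <=[Gamma] c -> b && a <=[Gamma] c.
Proof.
  intros E. unfold ImpH in E |- *.
  apply Imp_eqv_l with (b := (b && a)%F) in E;
    [|split; apply le_and; auto using le_andl, le_andr].
  refine (Imp_eqv_r _ E); split; repeat apply le_and;
    auto using le_and3, le_and3_mid, le_andr.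
Qed.

Lemma and_le_l a b c : a <=[Gamma] c -> a && b <=[Gamma] c.
Proof. intros E. now apply le_andC, and_le_r. Qed.

Lemma le_eqv_l a b c : eqv a b -> a <=[Gamma] c -> b <=[Gamma] c.
Proof.
  intros [ab ba] E. unfold ImpH in E |- *.
  apply Imp_eqv_l with (b := b) in E; [|now split].
  refine (Imp_eqv_r _ E); split; apply le_and;
    auto using and_le_l, le_andr.
Qed.

Lemma le_trans b a c : a <=[Gamma] b -> b <=[Gamma] c -> a <=[Gamma] c.
Proof.
  intros ab bc. apply le_eqv_l with (a && b)%F.
  - split; [apply le_andl|apply le_and; [apply le_refl|exact ab]].
  - now apply and_le_r.
Qed.

Lemma eqv_refl a : eqv a a.
Proof. split; apply le_refl. Qed.

Lemma eqv_trans b a c : eqv a b -> eqv b c -> eqv a c.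
Proof. intros [? ?] [? ?]; split; now apply le_trans with b. Qed.

Lemma le_orl a b : a <=[Gamma] a || b.
Proof. exact (Ax (A1 a b)). Qed.

Lemma le_orr a b : b <=[Gamma] a || b.
Proof. exact (Ax (A2 a b)). Qed.

Lemma or_le a b c : a <=[Gamma] c -> b <=[Gamma] c -> a || b <=[Gamma] c.
Proof. intros ac bc. exact (SMP bc (SMP ac (Ax (A3 a b c)))). Qed.

Lemma le_orl_trans a b c : c <=[Gamma] a -> c <=[Gamma] a || b.
Proof. intros E. exact (le_trans E (le_orl a b)). Qed.

Lemma le_orr_trans a b c : c <=[Gamma] b -> c <=[Gamma] a || b.
Proof. intros E. exact (le_trans E (le_orr a b)). Qed.

Lemma le_Top a : a <=[Gamma] Top.
Proof. apply le_thm, Ax, A6. Qed.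

Lemma Bot_le a : Bot <=[Gamma] a.
Proof. exact (Ax (A7 a)). Qed.

Lemma Top_le a : Top <=[Gamma] a <-> DHMSH_logic Gamma a.
Proof. split; [exact (SMP (Ax A6))|apply le_thm]. Qed.

Lemma eqv_Top a : eqv a Top <-> DHMSH_logic Gamma a.
Proof.
  unfold eqv. rewrite Top_le. split; [now intros []|split; [apply le_Top|assumption]].
Qed.

(** The next two lemmas are (A10) and (A11) localized at a formula [e] below
    which [a] and [b] are equivalent. *)
Lemma Imp_congl_at e a b c : e && a <=[Gamma] b -> e && b <=[Gamma] a ->
  e && (a --> c) <=[Gamma] (b --> c).
Proof.
  intros ab ba. apply le_uncurry.
  apply le_trans with ((a -->H b) && (b -->H a))%F.
  - apply le_and; now apply le_curry.
  - apply le_uncurry, Ax, A10.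
Qed.

Lemma Imp_congr_at e a b c : e && a <=[Gamma] b -> e && b <=[Gamma] a ->
  e && (c --> a) <=[Gamma] (c --> b).
Proof.
  intros ab ba. apply le_uncurry.
  apply le_trans with ((b -->H a) && (a -->H b))%F.
  - apply le_and; now apply le_curry.
  - apply le_uncurry, Ax, A11.
Qed.

Lemma Or_eqv a a' b b' : eqv a a' -> eqv b b' -> eqv (a || b) (a' || b').
Proof.
  intros [? ?] [? ?]; split; apply or_le;
    auto using le_orl_trans, le_orr_trans.
Qed.

Lemma And_eqv a a' b b' : eqv a a' -> eqv b b' -> eqv (a && b) (a' && b').
Proof.
  intros [? ?] [? ?]; split; apply le_and; auto using and_le_l, and_le_r.
Qed.

Lemma Imp_eqv a a' b b' : eqv a a' -> eqv b b' -> eqv (a --> b) (a' --> b').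
Proof.
  intros [aa' a'a] [bb' b'b]; split;
    [apply le_trans with (a' --> b)%F|apply le_trans with (a --> b')%F].
  - exact (SMP a'a (SMP aa' (Ax (A10 a a' b)))).
  - exact (SMP bb' (SMP b'b (Ax (A11 b' b a')))).
  - exact (SMP aa' (SMP a'a (Ax (A10 a' a b')))).
  - exact (SMP b'b (SMP bb' (Ax (A11 b b' a)))).
Qed.

Lemma Neg_eqv a a' : eqv a a' -> eqv (~~ a) (~~ a').
Proof. intros [? ?]; split; now apply SCP. Qed.

Lemma Imp_Top_eqv a : eqv (Top --> a) a.
Proof.
  assert (E : eqv (Top --> a) (Top -->H a)).
  { apply Imp_eqv; [apply eqv_refl|].
    split; [apply le_and; [apply le_Top|apply le_refl]|apply le_andr]. }
  apply (eqv_trans E). split; [|apply le_const].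
  apply le_trans with ((Top -->H a) && Top)%F.
  - apply le_and; [apply le_refl|apply le_Top].
  - apply le_uncurry, le_refl.
Qed.

Lemma And_Imp_eqv a b : eqv (a && (a --> b)) (a && b).
Proof.
  (* Below [a], the formulas [a] and [Top] are equivalent. *)
  split; apply le_and; try apply le_andl.
  - apply le_trans with (Top --> b)%F; [|apply Imp_Top_eqv].
    apply Imp_congl_at; [apply le_Top|apply le_andl].
  - apply le_trans with (a && (Top --> b))%F.
    + apply le_and; [apply le_andl|apply and_le_r, Imp_Top_eqv].
    + apply Imp_congl_at; [apply le_andl|apply le_Top].
Qed.

Lemma And_Imp_And_eqv a b c :
  eqv (a && (b --> c)) (a && ((a && b) --> (a && c))).
Proof.
  split; apply le_and; try apply le_andl.
  - apply le_trans with (a && ((a && b) --> c))%F.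
    + apply le_and; [apply le_andl|].
      apply Imp_congl_at; auto using le_refl, le_andr, and_le_r.
    + apply Imp_congr_at; auto using le_refl, le_andr, and_le_r.
  - apply le_trans with (a && (b --> (a && c)))%F.
    + apply le_and; [apply le_andl|].
      apply Imp_congl_at; auto using le_refl, le_andr, and_le_r.
    + apply Imp_congr_at; auto using le_refl, le_andr, and_le_r.
Qed.

Lemma Imp_refl_eqv a : eqv (a --> a) Top.
Proof.
  apply eqv_Top. refine (Imp_eqv_r _ (le_refl a)).
  split; [apply le_andl|apply le_and; apply le_refl].
Qed.

Lemma Neg_And_eqv a b : eqv (~~ (a && b)) (~~ a || ~~ b).
Proof.
  split; [exact (Ax (A14 a b))|].
  apply or_le; apply SCP; [apply le_andl|apply le_andr].
Qed.

End Logic.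

Arguments eqv : clear implicits.

(** * The Lindenbaum algebra *)

(** A chosen representative of the equivalence class of [a]. *)
Definition rep (Gamma : formula -> Prop) (a : formula) : formula :=
  epsilon (inhabits Bot) (eqv Gamma a).

Lemma rep_eqv (Gamma : formula -> Prop) (a : formula) :
  eqv Gamma a (rep Gamma a).
Proof. unfold rep. apply epsilon_spec. exists a. apply eqv_refl. Qed.

Lemma rep_eq (Gamma : formula -> Prop) (a b : formula) :
  rep Gamma a = rep Gamma b <-> eqv Gamma a b.
Proof.
  split; intros E.
  - apply eqv_trans with (rep Gamma a); [apply rep_eqv|].
    rewrite E. apply eqv_sym, rep_eqv.
  - unfold rep. f_equal. apply functional_extensionality; intros c.
    apply propositional_extensionality; split; apply eqv_trans;
      [now apply eqv_sym|exact E].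
Qed.

(** The quotient of the formulas by [eqv Gamma], realized as the set of the
    chosen representatives, so that equality is equivalence. *)
Definition quot (Gamma : formula -> Prop) : Type :=
  { a : formula | rep Gamma a = a }.

(** The class of a formula. *)
Definition cls (Gamma : formula -> Prop) (a : formula) : quot Gamma :=
  exist _ (rep Gamma a)
    (proj2 (rep_eq Gamma _ _) (eqv_sym (rep_eqv Gamma a))).

Lemma cls_eq (Gamma : formula -> Prop) (a b : formula) :
  cls Gamma a = cls Gamma b <-> eqv Gamma a b.
Proof.
  rewrite <- rep_eq. split; intros E.
  - exact (f_equal (@proj1_sig _ _) E).
  - unfold cls. apply subset_eq_compat, E.
Qed.

Lemma cls_surj (Gamma : formula -> Prop) (x : quot Gamma) :
  exists a, x = cls Gamma a.
Proof.
  destruct x as [a E]. exists a. apply subset_eq_compat. now symmetry.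
Qed.

Definition lindenbaum (Gamma : formula -> Prop) : algebra := {|
  carrier := quot Gamma;
  join := fun x y => cls Gamma (proj1_sig x || proj1_sig y);
  meet := fun x y => cls Gamma (proj1_sig x && proj1_sig y);
  imp := fun x y => cls Gamma (proj1_sig x --> proj1_sig y);
  neg := fun x => cls Gamma (~~ proj1_sig x);
  zero := cls Gamma Bot;
  one := cls Gamma Top |}.

Lemma join_cls (Gamma : formula -> Prop) (a b : formula) :
  @join (lindenbaum Gamma) (cls Gamma a) (cls Gamma b) = cls Gamma (a || b).
Proof. apply cls_eq, Or_eqv; apply eqv_sym, rep_eqv. Qed.

Lemma meet_cls (Gamma : formula -> Prop) (a b : formula) :
  @meet (lindenbaum Gamma) (cls Gamma a) (cls Gamma b) = cls Gamma (a && b).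
Proof. apply cls_eq, And_eqv; apply eqv_sym, rep_eqv. Qed.

Lemma imp_cls (Gamma : formula -> Prop) (a b : formula) :
  @imp (lindenbaum Gamma) (cls Gamma a) (cls Gamma b) = cls Gamma (a --> b).
Proof. apply cls_eq, Imp_eqv; apply eqv_sym, rep_eqv. Qed.

Lemma neg_cls (Gamma : formula -> Prop) (a : formula) :
  @neg (lindenbaum Gamma) (cls Gamma a) = cls Gamma (~~ a).
Proof. apply cls_eq, Neg_eqv, eqv_sym, rep_eqv. Qed.

(** Turns an equation of the Lindenbaum algebra into an equivalence. *)
Ltac to_eqv :=
  intros;
  repeat match goal with
  | x : carrier (lindenbaum ?G) |- _ =>
      let a := fresh "a" in destruct (cls_surj x) as [a ->]
  end;
  change (@zero (lindenbaum ?G)) with (cls G Bot);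
  change (@one (lindenbaum ?G)) with (cls G Top);
  repeat rewrite ?join_cls, ?meet_cls, ?imp_cls, ?neg_cls;
  apply cls_eq.

(** Proves equivalences of formulas that express the lattice axioms. *)
Ltac lattice_eqv :=
  split; repeat (apply or_le || apply le_and);
  auto 6 using le_refl, Bot_le, le_Top, and_le_l, and_le_r,
    le_orl_trans, le_orr_trans.

Lemma lindenbaum_lattice (Gamma : formula -> Prop) :
  is_bounded_lattice (lindenbaum Gamma).
Proof. split; to_eqv; lattice_eqv. Qed.

Lemma lindenbaum_DHMSH (Gamma : formula -> Prop) : DHMSH (lindenbaum Gamma).
Proof.
  split; [split|..].
  - apply lindenbaum_lattice.
  - to_eqv. apply And_Imp_eqv.
  - to_eqv. apply And_Imp_And_eqv.
  - to_eqv. apply Imp_refl_eqv.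
  - to_eqv. split; [apply le_Top|exact (Ax A12)].
  - to_eqv. split; [exact (Ax A13)|apply Bot_le].
  - to_eqv. apply Neg_And_eqv.
Qed.

Lemma eval_lindenbaum (Gamma : formula -> Prop) (a : formula) :
  eval (lindenbaum Gamma) (fun v => cls Gamma (Var v)) a = cls Gamma a.
Proof.
  induction a as [v|a IHa b IHb|a IHa b IHb|a IHa b IHb|a IHa| |]; cbn [eval];
    rewrite ?IHa, ?IHb;
    auto using join_cls, meet_cls, imp_cls, neg_cls.
Qed.

Lemma eval_lindenbaum_one (Gamma : formula -> Prop) (a : formula) :
  eval (lindenbaum Gamma) (fun v => cls Gamma (Var v)) a = one <->
  DHMSH_logic Gamma a.
Proof.
  rewrite eval_lindenbaum, <- eqv_Top. apply cls_eq.
Qed.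

(** * Algebraizability *)

(** The defining identity [de] expresses that its variable takes the value 1. *)
Definition expresses_one (de : identity unit) : Prop :=
  forall (A : algebra), DHMSH A -> forall (h : nat -> A) (phi : formula),
    satisfies A h (inst_identity de phi) <-> eval A h phi = one.

Lemma expresses_one_1 : expresses_one defining_identity_1.
Proof. intros A D h phi. reflexivity. Qed.

Lemma expresses_one_H : expresses_one defining_identity_H.
Proof.
  intros A D h phi.
  pose proof (DHMSH_semi_Heyting D) as H.
  change (eval A h phi = impH (eval A h phi) (eval A h phi) <->
          eval A h phi = one).
  rewrite (proj2 (impH_eq_one H _ _)); [reflexivity|].
  apply (below_refl (semi_Heyting_lattice H)).
Qed.

Lemma translation_satisfied (de : identity unit) (E : expresses_one de)
    (A : algebra) (D : DHMSH A) (h : nat -> A) (Gamma : formula -> Prop) :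
  (forall e, translation [de] Gamma e -> satisfies A h e) <->
  (forall psi, Gamma psi -> eval A h psi = one).
Proof.
  split.
  - intros S psi Hpsi. apply (E A D), S. exists de, psi. now split; [left|].
  - intros S e (de' & psi & [<-|[]] & Hpsi & ->). apply (E A D). now apply S.
Qed.

Lemma expresses_one_semantics (de : identity unit) :
  expresses_one de -> algebraic_semantics DHMSH_logic DHMSH [de].
Proof.
  intros E. split; [discriminate|]. intros Gamma phi de' [<-|[]]. split.
  - intros d A D h S. apply (E A D).
    apply (soundness D h) with (2 := d).
    exact (proj1 (translation_satisfied E D h Gamma) S).
  - intros C. apply eval_lindenbaum_one.
    apply (E _ (lindenbaum_DHMSH Gamma)), C; [apply lindenbaum_DHMSH|].
    apply (translation_satisfied E (lindenbaum_DHMSH Gamma)).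
    intros psi Hpsi. now apply eval_lindenbaum_one, Hyp.
Qed.

Lemma DHMSH_Delta_one (A : algebra) (D : DHMSH A) (h : nat -> A)
    (phi psi : formula) :
  (forall chi, (exists F, In F DHMSH_Delta /\ chi = inst2 F phi psi) ->
     eval A h chi = one) <->
  eval A h phi = eval A h psi.
Proof.
  pose proof (DHMSH_semi_Heyting D) as H.
  pose proof (semi_Heyting_lattice H) as L.
  split.
  - intros S. apply (below_antisym L); apply (impH_eq_one H).
    + apply (S (phi -->H psi)%F). exists (Var false -->H Var true)%F.
      now split; [left|].
    + apply (S (psi -->H phi)%F). exists (Var true -->H Var false)%F.
      now split; [right; left|].
  - intros S chi (F & [<-|[<-|[]]] & ->).
    + change (impH (eval A h phi) (eval A h psi) = one).
      apply (impH_eq_one H). rewrite S. apply (below_refl L).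
    + change (impH (eval A h psi) (eval A h phi) = one).
      apply (impH_eq_one H). rewrite S. apply (below_refl L).
Qed.

Lemma expresses_one_equivalent (de : identity unit) : expresses_one de ->
  equivalent_algebraic_semantics DHMSH_logic DHMSH [de] DHMSH_Delta.
Proof.
  intros E. split; [now apply expresses_one_semantics|].
  intros phi psi E'. split.
  - intros e He A D h S. revert e He.
    apply (translation_satisfied E D), (DHMSH_Delta_one D).
    now apply (S (phi, psi)).
  - intros A D h S. apply (DHMSH_Delta_one D).
    now apply (translation_satisfied E D).
Qed.

Theorem corollary5p4 :
  algebraizable DHMSH_logic /\
  equivalent_algebraic_semantics DHMSH_logic DHMSH
    [defining_identity_H] DHMSH_Delta /\
  (forall phi : formula,
     entails DHMSH (fun e => e = inst_identity defining_identity_H phi)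
       (inst_identity defining_identity_1 phi) /\
     entails DHMSH (fun e => e = inst_identity defining_identity_1 phi)
       (inst_identity defining_identity_H phi)) /\
  equivalent_algebraic_semantics DHMSH_logic DHMSH
    [defining_identity_1] DHMSH_Delta.
Proof.
  pose proof (expresses_one_equivalent expresses_one_H) as EH.
  split; [now exists DHMSH, [defining_identity_H], DHMSH_Delta|].
  split; [exact EH|].
  split; [|exact (expresses_one_equivalent expresses_one_1)].
  intros phi; split; intros A D h S.
  - apply (expresses_one_1 D), (expresses_one_H D). exact (S _ eq_refl).
  - apply (expresses_one_H D), (expresses_one_1 D). exact (S _ eq_refl).
Qed.
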